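(* For all positive integers $a$ and $b$, the following are equivalent: (i) every $K_5$-minor-free graph is $(a:b)$-choosable; (ii) $\frac{a}{b} \ge 5$.
   Context: All graphs are finite and simple. A graph is $K_5$-minor-free if it does not have the complete graph $K_5$ as a minor. For an assignment $L$ of lists (finite sets) of colors to the vertices of a graph $G$, a $b$-fold $L$-coloring of $G$ is a mapping $\varphi$ that assigns to each vertex $v$ a set $\varphi(v)\subseteq L(v)$ with $|\varphi(v)| = b$, such that $\varphi(u)\cap\varphi(v)=\varnothing$ whenever $u$ and $v$ are adjacent. For positive integers $a,b$, a graph $G$ is $(a:b)$-choosable if, for each list assignment $L$ with $|L(v)| = a$ for every vertex $v$, $G$ admits a $b$-fold $L$-coloring. *)

(* Defs.v *)
From HB Require Import structures.
From mathcomp Require Import all_boot all_order all_algebra.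

Set Implicit Arguments.
Unset Strict Implicit.
Unset Printing Implicit Defensive.

(* Finite simple graphs; the vertex set may be empty. *)
Record sgraph := SGraph {
  vertex :> finType;
  adj : rel vertex;
  adj_sym : symmetric adj;
  adj_irrefl : irreflexive adj
}.

Lemma complete_sym n : symmetric (fun i j : 'I_n => i != j).
Proof. by move=> i j; rewrite eq_sym. Qed.

Lemma complete_irrefl n : irreflexive (fun i j : 'I_n => i != j).
Proof. by move=> i; rewrite eqxx. Qed.

Definition complete (n : nat) : sgraph :=
  SGraph (@complete_sym n) (@complete_irrefl n).

(* The subgraph of G induced by A is connected (in particular nonempty). *)
Definition connected_set (G : sgraph) (A : {set G}) : Prop :=
  A != set0 /\
  {in A &, forall x y,
     connect [rel u v | [&& u \in A, v \in A & adj u v]] x y}.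

(* H is a minor of G when G contains a model of H: the branch sets [M h] are
   the connected sets that contract to the vertices of H. Extra edges and
   vertices of G are deleted, so adjacency is only required in one direction. *)
Definition minor_model (H G : sgraph) (M : H -> {set G}) : Prop :=
  [/\ forall h : H, connected_set (M h),
      forall h k : H, h != k -> [disjoint M h & M k]
    & forall h k : H, adj h k ->
        exists x y : G, [/\ x \in M h, y \in M k & adj x y]].

Definition is_minor (H G : sgraph) : Prop :=
  exists M : H -> {set G}, minor_model M.

Definition minor_free (H G : sgraph) : Prop := ~ is_minor H G.

Definition fold_coloring (b : nat) (G : sgraph) (C : finType)
    (L phi : G -> {set C}) : Prop :=
  [/\ forall v : G, phi v \subset L v,
      forall v : G, #|phi v| = b
    & forall u v : G, adj u v -> phi u :&: phi v = set0].

(* The color type C is arbitrary but finite: since G and the lists are finite,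
   only finitely many colors ever occur in a list assignment. *)
Definition choosable (a b : nat) (G : sgraph) : Prop :=
  forall (C : finType) (L : G -> {set C}),
    (forall v : G, #|L v| = a) ->
    exists phi : G -> {set C}, fold_coloring b L phi.

(* Main.v *)
(** For the upper bound, Thomassen's induction for planar graphs is run with
    the outer face replaced by the neighborhood [X] of an apex [a] such that
    [G + a] has no K5 minor: the vertices of [X] have lists of size [3b], the
    others lists of size [5b], and a clique [P] of at most two vertices of [X]
    is precolored.  Deleting a vertex of [X] and moving its neighbors into [X]
    is the contraction of an edge at [a], so no embedding and no structure
    theorem are needed.  If no vertex of [X \ P] can be deleted, then [X \ P]
    contains a cycle, and the component [E] of [P] in the rest of [G] has at
    most two neighbors on it: with three, [a], [E] and three arcs of the cycle
    would form a K5 minor.  These neighbors separate [G] into two smaller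
    instances.

    For the lower bound, one octahedron is glued on a common triangle for each
    coloring of that triangle.  With lists of size [5b - 1], the lists of the
    outer triangle contain the colors of their inner neighbors and the same
    [3b - 1] fresh colors, too few for the [3b] colors it needs. *)
Require Import Defs.
From HB Require Import structures.
From mathcomp Require Import all_boot all_order all_algebra.
From mathcomp Require Import zify.

Set Implicit Arguments.
Unset Strict Implicit.
Unset Printing Implicit Defensive.

(** * Minors inside a vertex set *)

Definition induced_rel (T : finType) (e : rel T) (A : {set T}) : rel T :=
  fun u v => [&& u \in A, v \in A & e u v].
Arguments induced_rel T e A u v /.

Definition connected_in (T : finType) (e : rel T) (A : {set T}) : bool :=
  (A != set0) &&
  [forall x in A, forall y in A, connect (induced_rel e A) x y].

Definition touch (T : finType) (e : rel T) (A B : {set T}) : bool :=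
  [disjoint A & B] && [exists x in A, exists y in B, e x y].

(** The relation and the vertex set are separate parameters, so that deletions shrink [W] and
    contractions change [e] while the vertex type stays fixed. *)
Definition K5_minor_in (T : finType) (e : rel T) (W : {set T}) : Prop :=
  exists s : seq {set T},
    [/\ size s = 5, all (fun A => connected_in e A && (A \subset W)) s
      & pairwise (touch e) s].

Definition component (T : finType) (e : rel T) (A : {set T}) (x : T) :=
  [set y | connect (induced_rel e A) x y].

Lemma subset_of_card (C : finType) (A : {set C}) n :
  n <= #|A| -> exists2 B : {set C}, B \subset A & #|B| = n.
Proof.
move=> leqn; exists [set x in take n (enum A)].
  by apply/subsetP=> x; rewrite inE => /mem_take; rewrite mem_enum.
rewrite cardsE (card_uniqP _) ?take_uniq ?enum_uniq // size_take -cardE.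
by case: ltnP => // ?; apply/eqP; rewrite eqn_leq leqn andbT.
Qed.

Lemma sym_induced_rel (T : finType) (e : rel T) A :
  symmetric e -> symmetric (induced_rel e A).
Proof. by move=> sym_e u v; rewrite /induced_rel /= sym_e andbCA. Qed.

Lemma sym_connect_induced (T : finType) (e : rel T) A :
  symmetric e -> connect_sym (induced_rel e A).
Proof. by move=> /sym_induced_rel sym_A; apply: sym_connect_sym. Qed.

Lemma connect_induced_subset (T : finType) (e : rel T) (A B : {set T}) x y :
  A \subset B -> connect (induced_rel e A) x y -> connect (induced_rel e B) x y.
Proof.
move=> /subsetP sAB; apply: connect_sub => u v /and3P[uA vA euv].
by apply: connect1; rewrite /= !sAB.
Qed.

Lemma connected_in_rooted (T : finType) (e : rel T) (A : {set T}) x :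
  symmetric e -> x \in A ->
  {in A, forall y, connect (induced_rel e A) x y} -> connected_in e A.
Proof.
move=> sym_e xA cxA; apply/andP; split; first by apply/set0Pn; exists x.
apply/forall_inP=> y yA; apply/forall_inP=> z zA.
by apply: connect_trans (cxA z zA); rewrite sym_connect_induced // cxA.
Qed.

Lemma connected_inP (T : finType) (e : rel T) (A : {set T}) x y :
  connected_in e A -> x \in A -> y \in A -> connect (induced_rel e A) x y.
Proof. by case/andP=> _ /forall_inP cA /cA /forall_inP; apply. Qed.

Lemma connected_in1 (T : finType) (e : rel T) x :
  symmetric e -> connected_in e [set x].
Proof.
move=> sym_e; apply: (@connected_in_rooted _ _ _ x); rewrite ?set11 //.
by move=> y /set1P ->.
Qed.

Lemma connected_in_path (T : finType) (e : rel T) x s :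
  symmetric e -> path e x s -> connected_in e [set z in x :: s].
Proof.
move=> sym_e; elim/last_ind: s => [|s y IHs] xsP.
  by rewrite (_ : [set z in _] = [set x]) ?connected_in1 //; apply/setP=> z; rewrite !inE.
move: xsP; rewrite rcons_path => /andP[/IHs cxs ey].
apply: (@connected_in_rooted _ _ _ x); rewrite ?inE ?eqxx // => z.
have sub: [set z in x :: s] \subset [set z in x :: rcons s y].
  by apply/subsetP=> w; rewrite !inE mem_rcons inE => /orP[]->; rewrite ?orbT.
have cx w : w \in x :: s -> connect (induced_rel e [set z in x :: rcons s y]) x w.
  move=> ws; apply: (connect_induced_subset sub).
  by apply: connected_inP => //; rewrite inE // mem_head.
rewrite inE -rcons_cons mem_rcons inE => /orP[/eqP -> | zs]; last exact: cx.
apply: connect_trans (cx (last x s) (mem_last _ _)) (connect1 _).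
rewrite /= ey !in_set -!rcons_cons !mem_rcons mem_head andbT.
by rewrite in_cons mem_last orbT.
Qed.

Lemma touch_sym (T : finType) (e : rel T) : symmetric e -> symmetric (touch e).
Proof.
move=> sym_e A B; rewrite /touch disjoint_sym; congr (_ && _).
by apply/exists_inP/exists_inP => [] [x xA /exists_inP[y yA exy]];
  exists y => //; apply/exists_inP; exists x => //; rewrite sym_e.
Qed.

Lemma touchI (T : finType) (e : rel T) (A B : {set T}) x y :
  [disjoint A & B] -> x \in A -> y \in B -> e x y -> touch e A B.
Proof.
move=> dAB xA yB exy; rewrite /touch dAB; apply/exists_inP; exists x => //.
by apply/exists_inP; exists y.
Qed.

Lemma mem_component (T : finType) (e : rel T) A x : x \in component e A x.
Proof. by rewrite inE. Qed.

Lemma component_subset (T : finType) (e : rel T) (A : {set T}) x :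
  x \in A -> component e A x \subset A.
Proof.
move=> xA; apply/subsetP=> y; rewrite inE => /connectP[p + ->].
by elim: p x xA => //= z p IHp x xA /andP[/and3P[_ zA _]]; apply: IHp.
Qed.

Lemma component_closed (T : finType) (e : rel T) (A : {set T}) x u v :
  x \in A -> u \in component e A x -> v \in A -> e u v -> v \in component e A x.
Proof.
move=> xA uE vA euv; have uA := subsetP (component_subset e xA) u uE.
rewrite !inE in uE *; apply: connect_trans uE (connect1 _).
by rewrite /= uA vA.
Qed.

Lemma component_connected (T : finType) (e : rel T) (A : {set T}) x :
  symmetric e -> x \in A -> connected_in e (component e A x).
Proof.
move=> sym_e xA; apply: (@connected_in_rooted _ _ _ x); rewrite ?mem_component //.
move=> y; rewrite inE => /connectP[p + ->].
elim/last_ind: p => [_|p z IHp]; first exact: connect0.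
rewrite rcons_path last_rcons => /andP[xp ez].
apply: connect_trans (IHp xp) (connect1 _).
have lE: last x p \in component e A x by rewrite inE; apply/connectP; exists p.
case/and3P: ez => _ zA ez; rewrite /= lE ez andbT.
exact: component_closed lE zA ez.
Qed.

(* The edge set of [e'] may be larger than that of [e] only by what the
   contraction of [D] into [p] creates. *)
Lemma K5_minor_contract (T : finType) (e e' : rel T) (W W' D : {set T}) p :
  symmetric e -> W' \subset W -> D \subset W -> [disjoint D & W'] ->
  {in D, forall d, connect (induced_rel e (p |: D)) p d} ->
  {in W' &, forall u v, e' u v ->
     [|| e u v, (u == p) && [exists d in D, e d v]
       | (v == p) && [exists d in D, e d u]]} ->
  K5_minor_in e' W' -> K5_minor_in e W.
Proof.
move=> sym_e sW'W sDW dDW' cD e'E [s [sz_s s_ok s_pw]].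
(* The branch set through [p], if there is one, absorbs [D]; the others stay as they are. *)
pose F (M : {set T}) := if p \in M then M :|: D else M.
have sF (M : {set T}) : M \subset F M by rewrite /F; case: ifP => // _; apply: subsetUl.
have pF (M : {set T}) d : p \in M -> d \in D -> d \in F M.
  by rewrite /F => -> dD; rewrite inE dD orbT.
have cF (M : {set T}) d : p \in M -> d \in D -> connect (induced_rel e (F M)) p d.
  move=> pM dD; apply: connect_induced_subset (cD d dD).
  by rewrite /F pM subUset sub1set inE pM subsetUr.
have csym := @sym_connect_induced _ e _ sym_e.
exists [seq F M | M <- s]; split; first by rewrite size_map.
  apply/allP=> _ /mapP[M /(allP s_ok)/andP[cM sMW'] ->]; apply/andP; split; last first.
    by rewrite /F; case: ifP => _; rewrite ?subUset ?sDW ?(subset_trans sMW').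
  have cMF: {in M &, forall u v, connect (induced_rel e (F M)) u v}.
    move=> u v uM vM; have:= connected_inP cM uM vM.
    apply: connect_sub => {u v uM vM} u v /and3P[uM vM /e'E].
    have uF := subsetP (sF M) u uM; have vF := subsetP (sF M) v vM.
    case/(_ (subsetP sMW' u uM) (subsetP sMW' v vM))/or3P => [euv||].
    - by apply: connect1; rewrite /= uF vF.
    - case/andP=> /eqP up /exists_inP[d dD edv]; rewrite {u}up in uM uF *.
      apply: connect_trans (cF _ _ uM dD) (connect1 _).
      by rewrite /= vF edv pF.
    case/andP=> /eqP vp /exists_inP[d dD edv]; rewrite {v}vp in vM vF *.
    rewrite csym; apply: connect_trans (cF _ _ vM dD) (connect1 _).
    by rewrite /= uF edv pF.
  case/andP: cM => /set0Pn[x xM] _.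
  apply: (@connected_in_rooted _ _ _ x) => //; first exact: (subsetP (sF M)).
  move=> y; rewrite /F; case: ifP => pM; last by move=> yM; have:= cMF x y xM yM; rewrite /F pM.
  rewrite inE => /orP[yM|yD]; first by have:= cMF x y xM yM; rewrite /F pM.
  by have:= connect_trans (cMF x p xM pM) (cF _ _ pM yD); rewrite /F pM.
rewrite pairwise_map; apply: (sub_in_pairwise (P := fun M : {set T} => M \subset W')) s_pw.
  move=> M N sM sN /andP[dMN /exists_inP[x xM /exists_inP[y yN exy]]] /=.
  have dF: [disjoint F M & F N].
    have dD (K : {set T}) : K \subset W' -> K :&: D = set0.
      by move=> sK; apply/disjoint_setI0; rewrite disjoint_sym (disjointWr sK).
    rewrite -setI_eq0 /F; move: (dMN); rewrite -setI_eq0 => /eqP dMN0.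
    case: ifP => pM; case: ifP => pN; rewrite ?setIUl ?setIUr ?dMN0 //.
    - by have:= disjointFr dMN pM; rewrite pN.
    - by rewrite setIC dD ?setU0.
    - by rewrite dD ?setU0.
  have xF := subsetP (sF M) x xM; have yF := subsetP (sF N) y yN.
  case/or3P: (e'E x y (subsetP sM x xM) (subsetP sN y yN) exy) => [exy'||].
  - exact: touchI xF yF exy'.
  - case/andP=> /eqP xp /exists_inP[d dD edy]; rewrite xp in xM.
    by apply: touchI (pF _ _ xM dD) yF edy.
  case/andP=> /eqP yp /exists_inP[d dD edx]; rewrite yp in yN.
  by apply: touchI xF (pF _ _ yN dD) _; rewrite // sym_e.
by apply/allP=> M /(allP s_ok)/andP[].
Qed.

Lemma K5_minor_subset (T : finType) (e : rel T) (W W' : {set T}) :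
  W' \subset W -> K5_minor_in e W' -> K5_minor_in e W.
Proof.
move=> sW' [s [sz_s /allP s_ok s_pw]]; exists s; split => //.
by apply/allP=> A /s_ok/andP[-> /= /subset_trans]; apply.
Qed.

Definition add_clique (T : finType) (e : rel T) (S : {set T}) : rel T :=
  fun u v => e u v || [&& u \in S, v \in S & u != v].

(** With at most two vertices in [S], at most one edge $pq$ is added. If it is not already in [e],
    contracting the connected set [D] into [p] creates it, because [D] sees both ends and lies
    outside [W']. *)
Lemma K5_minor_add_clique (T : finType) (e : rel T) (W W' S : {set T}) :
  symmetric e -> W' \subset W -> #|S| <= 2 ->
  {in S &, forall p q, p != q -> e p q \/
     exists D : {set T}, [/\ D \subset W, [disjoint D & W'], connected_in e D
       & [exists d in D, e d p] && [exists d in D, e d q]]} ->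
  K5_minor_in (add_clique e S) W' -> K5_minor_in e W.
Proof.
move=> sym_e sW' S2 linkS.
have noD (S1 : {in S &, forall p q, p != q -> e p q}) :
    K5_minor_in (add_clique e S) W' -> K5_minor_in e W.
  case=> s [sz_s /allP s_ok s_pw].
  have eE: add_clique e S =2 e.
    move=> u v; rewrite /add_clique; case euv: (e u v) => //=.
    by apply/negP=> /and3P[uS vS /(S1 _ _ uS vS)]; rewrite euv.
  exists s; split=> //; last first.
    apply: sub_pairwise s_pw => A B; rewrite /touch => /andP[-> /=].
    by case/exists_inP=> x xA /exists_inP[y yB]; rewrite eE => exy;
      apply/exists_inP; exists x => //; apply/exists_inP; exists y.
  apply/allP=> A /s_ok/andP[cA sA]; rewrite (subset_trans sA) // andbT.
  case/andP: (cA) => A0 _; rewrite /connected_in A0.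
  apply/forall_inP=> x xA; apply/forall_inP=> y yA.
  rewrite (eq_connect (e' := induced_rel (add_clique e S) A)) ?(connected_inP cA) //.
  by move=> u v; rewrite /= eE.
have [S1|] := leqP #|S| 1.
  apply: noD => p q pS qS; have /card_le1_eqP := S1 => /(_ p q pS qS) ->.
  by rewrite eqxx.
move=> S1; have /cards2P[p [q [pq defS]]] : #|S| == 2 by rewrite eqn_leq S2.
have [pS qS] : p \in S /\ q \in S by rewrite defS !inE !eqxx orbT.
have [epq|[D [sDW dD cD /andP[/exists_inP[d1 d1D ed1] /exists_inP[d2 d2D ed2]]]]]
  := linkS p q pS qS pq.
  by apply: noD => u v; rewrite defS !inE => /orP[]/eqP-> /orP[]/eqP->; rewrite ?eqxx // sym_e.
apply: (@K5_minor_contract _ _ _ _ _ D p) => //.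
  move=> d dD'; apply: (@connect_trans _ _ d1).
    by apply: connect1; rewrite /= !inE eqxx d1D orbT sym_e.
  by apply: connect_induced_subset (subsetUr _ _) _; apply: connected_inP.
move=> u v _ _; rewrite /add_clique => /orP[->//|/and3P[]].
rewrite defS !inE => /orP[]/eqP-> /orP[]/eqP->; rewrite ?eqxx //= => _.
  by apply/orP; right; apply/orP; left; apply/exists_inP; exists d2.
by apply/orP; right; apply/orP; right; apply/exists_inP; exists d2.
Qed.

(** * Arcs of cycles and existence of cycles *)

Lemma mem_split (T : eqType) (x : T) (s : seq T) :
  x \in s -> exists s1 s2, s = s1 ++ x :: s2.
Proof. by case/splitPr=> s1 s2; exists s1, s2. Qed.

(** Since the cycle has length at least three, one of its two arcs between [p] and [q] has an inner
    vertex; the interior of that arc serves as [D]. *)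
Lemma cycle_link (T : finType) (e : rel T) (c : seq T) p q :
  symmetric e -> cycle e c -> uniq c -> 2 < size c ->
  p \in c -> q \in c -> p != q ->
  exists D : {set T}, [/\ D \subset [set x in c] :\: [set p; q], connected_in e D
     & [exists d in D, e d p] && [exists d in D, e d q]].
Proof.
move=> sym_e; wlog [c' ->] : c / exists c', c = p :: c'.
  move=> IH cyc un sz pc qc pq; have [i c' def_c] := rot_to pc.
  have [|||||||D [sD cD tD]] := IH (rot i c).
  - by exists c'.
  - by rewrite rot_cycle.
  - by rewrite rot_uniq.
  - by rewrite size_rot.
  - by rewrite mem_rot.
  - by rewrite mem_rot.
  - by [].
  exists D; split=> //; apply: subset_trans sD (setSD _ _).
  by apply/subsetP=> x; rewrite !inE mem_rot.
move=> cyc un sz _ qc pq.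
have /mem_split[s1 [s2 def_c']] : q \in c' by move: qc; rewrite inE eq_sym (negPf pq).
rewrite {}def_c' {c' qc} in cyc un sz *.
have arc x s : path e x s -> {subset x :: s <= p :: s1 ++ q :: s2} ->
    p \notin x :: s -> q \notin x :: s ->
    [exists d in x :: s, e d p] -> [exists d in x :: s, e d q] ->
    exists D : {set T},
      [/\ D \subset [set x in p :: s1 ++ q :: s2] :\: [set p; q], connected_in e D
        & [exists d in D, e d p] && [exists d in D, e d q]].
  move=> xs sub np nq tp tq; exists [set z in x :: s]; split.
  - apply/subsetP=> z; rewrite inE => zs; rewrite in_setD in_set (sub z zs) andbT !inE.
    by apply/norP; split; apply: contraTneq zs => ->.
  - exact: connected_in_path.
  by apply/andP; split; [case/exists_inP: tp | case/exists_inP: tq] => d ds ed;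
     apply/exists_inP; exists d; rewrite ?in_set.
move: cyc; rewrite /= rcons_cat cat_path /= rcons_path => /and3P[ps1 s1q /andP[qs2 s2p]].
move: un => /= /andP[]; rewrite mem_cat !inE !negb_or => /and3P[ps1N _ ps2N].
rewrite cat_uniq /= !negb_or => /and3P[_ /andP[qs1N _] /andP[qs2N _]].
case: s1 => [|x s1] in sz ps1 s1q ps1N qs1N arc *.
  case: s2 => [//|x s2] in sz qs2 s2p ps2N qs2N arc *.
  move: qs2 => /= /andP[qx xs2].
  apply: (arc x s2) => //.
  - by move=> z zs; rewrite /= in_cons in_cons zs !orbT.
  - by apply/exists_inP; exists (last x s2); rewrite ?mem_last.
  - by apply/exists_inP; exists x; rewrite ?mem_head // sym_e.
move: ps1 => /= /andP[px xs1].
apply: (arc x s1) => //.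
- by move=> z zs; rewrite in_cons mem_cat zs !orbT.
- by apply/exists_inP; exists x; rewrite ?mem_head // sym_e.
- by apply/exists_inP; exists (last x s1); rewrite ?mem_last.
Qed.

(** The cycle is cut just before each of [p], [q] and [r]: each arc starts at one of the three
    vertices, and the cut edges link the arcs pairwise. [N] will be adjacency to a further branch
    set. *)
Lemma cycle_tripod (T : finType) (e : rel T) (c : seq T) (N : pred T) p q r :
  symmetric e -> cycle e c -> uniq c ->
  [/\ p \in c, q \in c & r \in c] -> [/\ p != q, q != r & r != p] ->
  [/\ N p, N q & N r] ->
  exists s : seq {set T}, [/\ size s = 3, pairwise (touch e) s
    & all (fun A => [&& connected_in e A, A \subset [set x in c]
                      & [exists x in A, N x]]) s].
Proof.
move=> sym_e cyc un [pc qc rc] [pq qr rp] [Np Nq Nr].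
wlog [c' def_c] : c cyc un pc qc rc / exists c', c = p :: c'.
  move=> IH; have [i c' def_c] := rot_to pc.
  have [||||||s [sz_s pw_s all_s]] := IH (rot i c).
  - by rewrite rot_cycle.
  - by rewrite rot_uniq.
  - by rewrite mem_rot.
  - by rewrite mem_rot.
  - by rewrite mem_rot.
  - by exists c'.
  exists s; split=> //; apply: sub_all all_s => A /and3P[-> sA ->]; rewrite andbT.
  by apply: subset_trans sA _; apply/subsetP=> x; rewrite !inE mem_rot.
wlog [s1 [s2 [s3 def_c']]] : q r qc rc pq qr rp Nq Nr /
    exists s1 s2 s3, c = p :: s1 ++ q :: s2 ++ r :: s3.
  move=> IH.
  have qc' : q \in c' by move: qc; rewrite def_c inE eq_sym (negPf pq).
  have rc' : r \in c' by move: rc; rewrite def_c inE (negPf rp).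
  have [s1 [s2 def_c']] := mem_split qc'.
  rewrite {}def_c' {c' qc'} in def_c rc' *.
  move: rc'; rewrite mem_cat inE eq_sym (negPf qr) /= => /orP[] rs.
    have [s3 [s4 def_s]] := mem_split rs; rewrite {}def_s in def_c.
    apply: (IH r q); rewrite // 1?eq_sym //.
    by exists s3, s4, s2; rewrite def_c -catA.
  have [s3 [s4 def_s]] := mem_split rs; rewrite {}def_s in def_c.
  by apply: (IH q r) => //; exists s1, s3, s4.
exists [:: [set x in p :: s1]; [set x in q :: s2]; [set x in r :: s3]].
rewrite {}def_c' {c' def_c pc qc rc} in cyc un *.
move: cyc; rewrite /= rcons_cat cat_path /= rcons_cat cat_path /= rcons_path.
case/and5P=> ps1 l1 qs2 l2 /andP[rs3 l3].
have disj (s t : seq T) : ~~ has (mem s) t -> [disjoint [set x in s] & [set x in t]].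
  move=> nst; rewrite disjoints_subset; apply/subsetP=> x; rewrite !inE => xs.
  by apply: contra nst => xt; apply/hasP; exists x.
move: un; rewrite -cat_cons cat_uniq => /and3P[_ d1 un].
move: d1; rewrite -cat_cons has_cat negb_or => /andP[d12 d13].
move: un; rewrite -cat_cons cat_uniq => /and3P[_ d23 _].
split=> //.
  rewrite /= !andbT -andbA; apply/and3P; split.
  - by apply: (@touchI _ _ _ _ (last p s1) q); rewrite ?disj // inE ?mem_last ?mem_head.
  - rewrite touch_sym //.
    by apply: (@touchI _ _ _ _ (last r s3) p); rewrite 1?disjoint_sym ?disj // inE ?mem_last ?mem_head.
  - by apply: (@touchI _ _ _ _ (last q s2) r); rewrite ?disj // inE ?mem_last ?mem_head.
rewrite /= !connected_in_path //= andbT; apply/and3P; split; apply/andP; split.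
- by apply/subsetP=> x; rewrite !inE !mem_cat !inE mem_cat inE; case/orP=> ->; rewrite ?orbT.
- by apply/exists_inP; exists p => //; rewrite !inE eqxx.
- by apply/subsetP=> x; rewrite !inE !mem_cat !inE mem_cat inE; case/orP=> ->; rewrite ?orbT.
- by apply/exists_inP; exists q => //; rewrite !inE eqxx.
- by apply/subsetP=> x; rewrite !inE !mem_cat !inE mem_cat inE; case/orP=> ->; rewrite ?orbT.
- by apply/exists_inP; exists r => //; rewrite !inE eqxx.
Qed.

(** A path grows from [z0]. Its end differs from [z0], so it has a neighbor in [Y] other than its
    predecessor, which prolongs the path or closes a cycle. The start itself only has to reach
    [z1]. *)
Lemma exists_cycle (T : finType) (e : rel T) (Y : {set T}) z0 z1 :
  symmetric e -> irreflexive e -> z0 \in Y -> z1 \in Y -> e z0 z1 ->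
  {in Y, forall z, z != z0 -> 1 < #|[set w in Y | e z w]|} ->
  exists c, [/\ cycle e c, uniq c, 2 < size c & {subset c <= Y}].
Proof.
move=> sym_e irr_e z0Y z1Y e01 deg.
have grow n : (exists c, [/\ cycle e c, uniq c, 2 < size c & {subset c <= Y}]) \/
    exists s, [/\ size s = n.+1, path e z0 s, uniq (z0 :: s) & {subset z0 :: s <= Y}].
  elim: n => [|n [|[s [sz_s ps us sY]]]]; [right| by left|].
    exists [:: z1]; split; rewrite //= ?e01 ?andbT //.
      by rewrite inE; apply: contraTneq e01 => ->; rewrite irr_e.
    by move=> z; rewrite !inE => /orP[]/eqP->.
  case/lastP: s => [//|s u] in sz_s ps us sY *.
  set v := last z0 s.
  move: ps; rewrite rcons_path => /andP[ps evu]; rewrite -/v in evu.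
  have uY : u \in Y by apply: sY; rewrite -rcons_cons mem_rcons mem_head.
  have uz0 : u != z0.
    by move: us; rewrite /= mem_rcons inE negb_or eq_sym => /andP[/andP[]].
  have /card_gt1P[w [w' [+ + ww']]] := deg u uY uz0.
  wlog wv : w w' ww' / w != v.
    move=> IH wu w'u; have [wv|] := eqVneq w v; last by move=> wv; apply: IH wu w'u.
    by apply: (IH w' w) => //; rewrite eq_sym // -wv.
  rewrite !inE => /andP[wY euw] _.
  have [ws|ws] := boolP (w \in z0 :: rcons s u); last first.
    right; exists (rcons (rcons s u) w); split.
    - by rewrite size_rcons sz_s.
    - by rewrite !rcons_path ps -/v evu last_rcons.
    - by rewrite -rcons_cons rcons_uniq ws.
    by move=> z; rewrite -[_ :: _]/(rcons (z0 :: rcons s u) w) mem_rcons inE => /orP[/eqP->|/sY].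
  left; have wu : w != u by apply: contraTneq euw => ->; rewrite irr_e.
  move: ws; rewrite -rcons_cons mem_rcons inE (negPf wu) /= => ws.
  have: path e z0 (rcons s u) by rewrite rcons_path ps.
  have defp : z0 :: rcons s u = rcons (z0 :: s) u by [].
  have [t1 [t2 def_s]] : exists t1 t2, z0 :: s = t1 ++ w :: t2.
    exact: mem_split.
  (* As [w] differs from the predecessor [v] of [u], some vertex lies between [w] and [u] on the
     path, and the cycle has length at least three. *)
  have t2n : 0 < size t2.
    case: t2 def_s => // def_s.
    by have:= congr1 (last z0) def_s; rewrite last_cat /= -/v => vw; rewrite vw eqxx in wv.
  have pw: path e w (rcons t2 u).
    have: sorted e (z0 :: rcons s u) by rewrite /= rcons_path ps.
    by rewrite defp def_s rcons_cat => /cat_sorted2[_].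
  exists (w :: rcons t2 u); split.
  - by rewrite /= rcons_path pw last_rcons.
  - by move: us; rewrite defp def_s rcons_cat cat_uniq => /and3P[].
  - by rewrite /= size_rcons !ltnS.
  move=> z zt; apply: sY; rewrite defp def_s rcons_cat mem_cat.
  by rewrite rcons_cons zt orbT.
have [//|[s [sz_s _ us _]]] := grow #|T|.
have: size (z0 :: s) <= #|T| by rewrite -(card_uniqP us) max_card.
by rewrite /= sz_s ltnNge leqnSn.
Qed.

(** * Reductions of apex instances *)

Definition coloring_on (T C : finType) (b : nat) (e : rel T) (V : {set T})
    (L phi : T -> {set C}) : Prop :=
  [/\ {in V, forall v, phi v \subset L v}, {in V, forall v, #|phi v| = b}
    & {in V &, forall u v, e u v -> [disjoint phi u & phi v]}].

Definition colorable_on (T C : finType) (b : nat) (e : rel T) (V : {set T})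
    (L : T -> {set C}) : Prop :=
  exists phi : T -> {set C}, coloring_on b e V L phi.

(* A precoloring of [P] is encoded by lists of size [b]. *)
Record apex_instance (T C : finType) (b : nat) (e : rel T) (a : T)
    (V P : {set T}) (L : T -> {set C}) : Prop := ApexInstance {
  inst_sym : symmetric e;
  inst_irr : irreflexive e;
  inst_apex : a \notin V;
  inst_free : ~ K5_minor_in e (a |: V);
  inst_sub : P \subset V;
  inst_card : #|P| <= 2;
  inst_adj : {in P, forall v, e a v};
  inst_clique : {in P &, forall u v, u != v -> e u v && [disjoint L u & L v]};
  inst_pre : {in P, forall v, #|L v| = b};
  inst_list : {in V :\: P, forall v, (if e a v then 3 * b else 5 * b) <= #|L v|}
}.

(** The measure drops when a vertex is deleted and also when the precoloring grows on an unchanged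
    [V]. Both [e] and [a] are quantified, since contractions alter the relation and a new apex may
    be chosen. *)
Definition colorable_below (T C : finType) (b n : nat) : Prop :=
  forall (e : rel T) a V P (L : T -> {set C}),
    apex_instance b e a V P L -> #|V| + #|V :\: P| < n -> colorable_on b e V L.

Lemma leq_card_setD (T : finType) (A B : {set T}) : #|A| <= #|A :\: B| + #|B|.
Proof. by have := cardsID B A; have := subset_leq_card (subsetIr A B); lia. Qed.

Lemma card_bigcup_const (I C : finType) (A : {set I}) (F : I -> {set C}) n :
  {in A, forall i, #|F i| <= n} -> #|\bigcup_(i in A) F i| <= #|A| * n.
Proof.
move=> Fn; rewrite -sum_nat_const.
apply: (@leq_trans (\sum_(i in A) #|F i|)); last exact: leq_sum.
elim/big_rec2: _ => [|i m B _ leBm]; first by rewrite cards0.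
by rewrite (leq_trans (leq_card_setU _ _)) ?leq_add2l.
Qed.

Lemma colorable_insert (T C : finType) b (e : rel T) (V : {set T}) z
    (L phi : T -> {set C}) (F : {set C}) :
  symmetric e -> irreflexive e -> coloring_on b e (V :\ z) L phi ->
  F \subset L z -> #|F| = b ->
  {in V :\ z, forall u, e z u -> [disjoint F & phi u]} -> colorable_on b e V L.
Proof.
move=> sym_e irr_e [sphi cphi dphi] sF cF dF.
exists (fun u => if u == z then F else phi u); split.
- by move=> u uV; have [->//|uz] := eqVneq u z; apply: sphi; rewrite !inE uz.
- by move=> u uV; have [//|uz] := eqVneq u z; apply: cphi; rewrite !inE uz.
move=> u v uV vV; have [->|uz] := eqVneq u z; have [->|vz] := eqVneq v z.
- by rewrite irr_e.
- by move=> ezv; apply: dF; rewrite // !inE vz.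
- by rewrite sym_e disjoint_sym => ezu; apply: dF; rewrite // !inE uz.
by move=> euv; apply: dphi; rewrite // !inE ?uz ?vz.
Qed.

(** Once colored with [F], the vertex [v] becomes the apex of [V :\ v]: its neighbors keep at least
    [4 * b] colors after losing [F], enough for the bound [3 * b] on outer lists. *)
Lemma color_from_vertex (T C : finType) b (e : rel T) (V : {set T}) v
    (L : T -> {set C}) :
  symmetric e -> irreflexive e -> ~ K5_minor_in e V -> v \in V ->
  {in V, forall u, 5 * b <= #|L u|} ->
  colorable_below T C b (#|V| + #|V|) -> colorable_on b e V L.
Proof.
move=> sym_e irr_e noK5 vV L5 IH.
have [F sFL cardF] : exists2 F : {set C}, F \subset L v & #|F| = b.
  by apply: subset_of_card; have := L5 v vV; lia.
pose L' u := if e v u then L u :\: F else L u.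
have [||phi [sphi cphi dphi]] := IH e v (V :\ v) set0 L'.
- split=> //; rewrite ?sub0set ?cards0 //; try by move=> u; rewrite inE.
  + by rewrite !inE eqxx.
  + by rewrite setD1K.
  move=> u; rewrite setD0 !inE => /andP[_ uV]; rewrite /L'; have := L5 u uV.
  case: ifP => _ //; have := leq_card_setD (L u) F; rewrite cardF; lia.
- by rewrite setD0; have := cardsD1 v V; rewrite vV; lia.
apply: (@colorable_insert _ _ _ _ _ v _ phi F) => //.
  split=> // u uV; apply: subset_trans (sphi u uV) _.
  by rewrite /L'; case: ifP => _; rewrite ?subsetDl.
move=> u uV evu; have := sphi u uV; rewrite /L' evu disjoint_sym.
by rewrite subsetD => /andP[].
Qed.

(* Deleting [z] and joining its neighbors to the apex is the contraction of an
   edge at the apex; the set [D] is kept in reserve for [z], and the remaining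
   uncolored outer neighbor of [z], if any, uses at most [b] of its colors. *)
Lemma color_delete_outer (T C : finType) b (e : rel T) a (V P : {set T}) z
    (L : T -> {set C}) (D : {set C}) :
  apex_instance b e a V P L -> z \in V -> e a z ->
  #|[set w in (V :\: P) :\ z | e a w && e z w]| <= 1 ->
  D \subset L z ->
  #|D| = (#|[set w in (V :\: P) :\ z | e a w && e z w]|).+1 * b ->
  {in P :\ z, forall v, e z v -> [disjoint D & L v]} ->
  colorable_below T C b (#|V| + #|V :\: P|) -> colorable_on b e V L.
Proof.
set N := [set w in _ | _] => inst zV eaz N1 sDL cardD dDP IH.
have [sym_e irr_e aV noK5 sPV P2 adjP cliqueP preP listP] := inst.
have az : a != z by apply: contraTneq eaz => ->; rewrite irr_e.
pose e' u v := [|| e u v, [&& u == a, v != a & e z v] | [&& v == a, u != a & e z u]].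
have e'V : {in V :\ z &, e' =2 e}.
  move=> u v; rewrite !inE /e' => /andP[_ uV] /andP[_ vV].
  have -> : u == a = false by apply: contraNF aV => /eqP <-.
  have -> : v == a = false by apply: contraNF aV => /eqP <-.
  by rewrite !orbF.
have e'a u : u \in V -> e' a u = e a u || e z u.
  move=> uV; have ua : u == a = false by apply: contraNF aV => /eqP <-.
  by rewrite /e' eqxx ua /= orbF.
(* Only the neighbors of [z] that become outer lose [D]. As [#|N| <= 1], the set [D] has at most
   [2 * b] colors, so these lists keep [3 * b]. *)
pose L' u := if [|| u \in P, e a u | ~~ e z u] then L u else L u :\: D.
have sL' u : L' u \subset L u by rewrite /L'; case: ifP => _; rewrite ?subsetDl.
have L'P u : u \in P -> L' u = L u by rewrite /L' => ->.
have [||phi [sphi cphi dphi]] := IH e' a (V :\ z) (P :\ z) L'.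
- split.
  + by move=> u v; rewrite /e' sym_e; case: (e v u) => //=; rewrite orbC.
  + by move=> u; rewrite /e' irr_e; case: eqP.
  + by rewrite !inE negb_and aV orbT.
  + move=> K5; apply: noK5; apply: (@K5_minor_contract _ e e' _ _ [set z] a) K5 => //.
    * by rewrite setUS ?subsetDl.
    * by rewrite sub1set !inE zV orbT.
    * by rewrite disjoints1 !inE eqxx eq_sym (negPf az).
    * by move=> d /set1P ->; apply: connect1; rewrite /= !inE !eqxx eaz ?orbT.
    move=> u v _ _ /or3P[-> //|/and3P[-> _ ezv]|/and3P[-> _ ezu]].
      apply/orP; right; apply/orP; left; apply/exists_inP; exists z => //.
      by rewrite inE.
    apply/orP; right; apply/orP; right; apply/exists_inP; exists z => //.
    by rewrite inE.
  + by rewrite setSD.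
  + by rewrite (leq_trans _ P2) // subset_leq_card ?subsetDl.
  + by move=> u /setD1P[_ uP]; rewrite e'a ?adjP // (subsetP sPV).
  + move=> u v /setD1P[_ uP] /setD1P[_ vP] uv; rewrite /= !L'P // /e'.
    by case/andP: (cliqueP u v uP vP uv) => -> ->.
  + by move=> u /setD1P[_ uP]; rewrite L'P ?preP.
  move=> u; rewrite !inE negb_and negbK => /andP[/orP[->//|uP] /andP[uz uV]].
  have := listP u; rewrite !inE uP uV e'a // /L' (negPf uP) => /(_ isT).
  case: (e a u) => //=; case: (e z u) => //=.
  have := leq_card_setD (L u) D; rewrite cardD; case: #|N| N1 => [|[|//]] _; lia.
- have zDz : #|(V :\ z) :\: (P :\ z)| <= #|V :\: P|.
    apply: subset_leq_card; apply/subsetP=> u; rewrite !inE.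
    by case: (u == z); rewrite //= andbF.
  by have := cardsD1 z V; rewrite zV; lia.
pose U := \bigcup_(w in N) phi w.
have NV w : w \in N -> w \in V :\ z by rewrite !inE => /andP[/and3P[-> _ ->]].
have cardU : #|U| <= #|N| * b.
  by apply: card_bigcup_const => w /NV /cphi ->.
have [F sF cardF] : exists2 F : {set C}, F \subset D :\: U & #|F| = b.
  by apply: subset_of_card; have := leq_card_setD D U; rewrite cardD; lia.
move: sF; rewrite subsetD => /andP[sFD dFU].
apply: (@colorable_insert _ _ _ _ _ z _ phi F) => //.
- split=> // [u uV|u v uV vV euv]; first exact: subset_trans (sphi u uV) (sL' u).
  by apply: dphi; rewrite ?e'V.
- exact: subset_trans sFD sDL.
move=> u uV ezu; have /setD1P[uz uVV] := uV.
have [uP|uP] := boolP (u \in P).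
  apply: disjointW sFD (subset_trans (sphi u uV) (sL' u)) _.
  by apply: dDP; rewrite ?inE ?uz.
have [eau|eau] := boolP (e a u).
  apply: disjointWr dFU; apply: bigcup_sup.
  by rewrite !inE uz uP uVV eau.
have := sphi u uV; rewrite /L' (negPf uP) (negPf eau) ezu /= subsetD => /andP[_ dD].
by rewrite disjoint_sym; apply: disjointWr sFD dD.
Qed.

(** Of the [3 * b] colors of [w], at most [b] are taken by [P]. Fixing [b] of the others makes [w]
    precolored, which lowers [#|V :\: P|] and leaves the graph alone. *)
Lemma color_extend_precoloring (T C : finType) b (e : rel T) a (V P : {set T}) w
    (L : T -> {set C}) :
  apex_instance b e a V P L -> #|P| <= 1 -> w \in V :\: P -> e a w ->
  {in P, forall v, e v w} ->
  colorable_below T C b (#|V| + #|V :\: P|) -> colorable_on b e V L.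
Proof.
move=> inst P1 wVP eaw adjw IH.
have [sym_e irr_e aV noK5 sPV P2 adjP cliqueP preP listP] := inst.
pose U := \bigcup_(v in P) L v.
have cardU : #|U| <= #|P| * b by apply: card_bigcup_const => v /preP ->.
have [F sF cardF] : exists2 F : {set C}, F \subset L w :\: U & #|F| = b.
  apply: subset_of_card; have := leq_card_setD (L w) U.
  have := listP w wVP; rewrite eaw; move: P1 cardU; case: #|P| => [|[|//]] _; lia.
move: sF; rewrite subsetD => /andP[sFL dFU].
have /setDP[wV wP] := wVP.
pose L' u := if u == w then F else L u.
have L'P u : u \in P -> L' u = L u.
  by move=> uP; rewrite /L'; case: eqP => // uw; rewrite uw (negPf wP) in uP.
have dFP u : u \in P -> [disjoint F & L u].
  by move=> uP; apply: disjointWr dFU; apply: bigcup_sup.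
have [||phi [sphi cphi dphi]] := IH e a V (w |: P) L'.
- split=> //.
  + by rewrite subUset sub1set wV.
  + by rewrite cardsU1 wP; lia.
  + by move=> u /setU1P[-> //|/adjP].
  + move=> u v /setU1P[->|uP] /setU1P[->|vP]; rewrite ?eqxx // => uv.
    * by rewrite sym_e adjw //= (L'P v) // /L' eqxx dFP.
    * by rewrite adjw //= (L'P u) // /L' eqxx disjoint_sym dFP.
    by rewrite !L'P // cliqueP.
  + by move=> u /setU1P[->|uP]; [rewrite /L' eqxx | rewrite L'P ?preP].
  move=> u; rewrite !inE negb_or -andbA => /and3P[uw uP uV].
  by rewrite /L' (negPf uw); apply: listP; rewrite inE uP.
- rewrite ltn_add2l; apply: proper_card; apply/properP; split.
    by rewrite setDS ?subsetUr.
  by exists w; rewrite // !inE eqxx.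
exists phi; split=> // u uV; apply: subset_trans (sphi u uV) _.
by rewrite /L'; case: eqP => // ->.
Qed.

(** The part [A] is colored first, then [B] with [S] precolored as in [A]. The edge added on [S]
    makes the colors found there disjoint, as a precolored clique requires; the hypotheses on minors
    say that it creates no K5 minor on either side. *)
Lemma color_separation (T C : finType) b (e : rel T) a (V P A B : {set T})
    (L : T -> {set C}) :
  apex_instance b e a V P L -> A :|: B = V -> P \subset A ->
  A != V -> B != V -> #|A :&: B| <= 2 -> {in A :&: B, forall v, e a v} ->
  {in A :\: B & B :\: A, forall u v, ~~ e u v} ->
  ~ K5_minor_in (add_clique e (A :&: B)) (a |: A) ->
  ~ K5_minor_in (add_clique e (A :&: B)) (a |: B) ->
  colorable_below T C b (#|V| + #|V :\: P|) -> colorable_on b e V L.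
Proof.
set S := A :&: B => inst ABV sPA AV BV S2 adjS noAB noKA noKB IH.
have [sym_e irr_e aV noK5 sPV P2 adjP cliqueP preP listP] := inst.
have sAV : A \subset V by rewrite -ABV subsetUl.
have sBV : B \subset V by rewrite -ABV subsetUr.
have ltA : #|A| < #|V| by rewrite proper_card // properEneq AV.
have ltB : #|B| < #|V| by rewrite proper_card // properEneq BV.
have notS v : v \notin A -> v \in S = false by rewrite inE => /negPf ->.
have aA : a \notin A by apply: contra aV; apply: subsetP.
have aB : a \notin B by apply: contra aV; apply: subsetP.
have e'a v : add_clique e S a v = e a v.
  by rewrite /add_clique notS ?orbF.
have sym_e' : symmetric (add_clique e S).
  by move=> u v; rewrite /add_clique sym_e eq_sym andbCA.
have irr_e' : irreflexive (add_clique e S).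
  by move=> u; rewrite /add_clique irr_e eqxx !andbF.
have [||phi [sphi cphi dphi]] := IH (add_clique e S) a A P L.
- split=> //.
  + by move=> v vP; rewrite e'a adjP.
  + by move=> u v uP vP uv; rewrite /add_clique; case/andP: (cliqueP u v uP vP uv) => -> ->.
  move=> v; rewrite e'a => /setDP[vA vP]; apply: listP.
  by rewrite inE vP (subsetP sAV).
- by have := subset_leq_card (setSD P sAV); lia.
have SA v : v \in S -> v \in A by case/setIP.
pose L' v := if v \in S then phi v else L v.
have [||psi [spsi cpsi dpsi]] := IH (add_clique e S) a B S L'.
- split=> //.
  + exact: subsetIr.
  + by move=> v vS; rewrite e'a adjS.
  + move=> u v uS vS uv; have euv: add_clique e S u v by rewrite /add_clique uS vS uv orbT.
    by rewrite euv /L' uS vS dphi ?SA.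
  + by move=> v vS; rewrite /L' vS cphi ?SA.
  move=> v /setDP[vB vS]; rewrite e'a /L' (negPf vS); apply: listP.
  rewrite inE (subsetP sBV) // andbT; apply: contra vS => /(subsetP sPA) vA.
  by rewrite inE vA.
- have sBS : B :\: S \subset V :\: P.
    apply/subsetP=> v /setDP[vB vS]; rewrite inE (subsetP sBV) // andbT.
    by apply: contra vS => /(subsetP sPA) vA; rewrite inE vA.
  by have := subset_leq_card sBS; lia.
have psiS v : v \in S -> psi v = phi v.
  move=> vS; apply/eqP; rewrite eqEcard cphi ?SA //.
  have /setIP[_ vB] := vS; rewrite cpsi // leqnn andbT.
  by have := spsi v vB; rewrite /L' vS.
have inB v : v \in V -> v \notin A -> v \in B.
  by rewrite -ABV inE => /orP[->|].
have psiB v : v \in B -> (if v \in A then phi v else psi v) = psi v.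
  by move=> vB; case: ifP => // vA; rewrite psiS // inE vA.
exists (fun v => if v \in A then phi v else psi v); split.
- move=> v vV; case: ifPn => vA; first exact: sphi.
  by have := spsi v (inB v vV vA); rewrite /L' notS.
- by move=> v vV; case: ifPn => vA; [apply: cphi | apply/cpsi/inB].
have e'e u v : e u v -> add_clique e S u v by rewrite /add_clique => ->.
move=> u v uV vV euv.
have [uA|uA] := boolP (u \in A); have [vA|vA] := boolP (v \in A).
- exact: dphi (e'e _ _ euv).
- have vB := inB v vV vA; have uB : u \in B.
    by apply: contraTT euv => uB; apply: noAB; rewrite inE ?uB ?vA.
  by rewrite -psiS ?inE ?uA ?uB //; apply: dpsi (e'e _ _ euv).
- have uB := inB u uV uA; have vB : v \in B.
    by apply: contraTT euv => vB; rewrite sym_e; apply: noAB; rewrite inE ?vB ?uA.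
  by rewrite -psiS ?inE ?vA ?vB //; apply: dpsi (e'e _ _ euv).
by apply: dpsi (e'e _ _ euv); apply: inB.
Qed.

(** * Twins and cycles in the neighborhood of the apex *)

Lemma touch1l (T : finType) (e : rel T) u v (B : {set T}) :
  u \notin B -> v \in B -> e u v -> touch e [set u] B.
Proof. by move=> uB vB; apply: touchI; rewrite ?disjoints1 ?set11. Qed.

(** The linking sets [D] lie in [V], hence miss the apex, so [K5_minor_add_clique] applies to
    [a |: W]. *)
Lemma inst_not_add_clique (T C : finType) b (e : rel T) a (V P W S : {set T})
    (L : T -> {set C}) :
  apex_instance b e a V P L -> W \subset V -> #|S| <= 2 ->
  {in S &, forall p q, p != q -> e p q \/
     exists D : {set T}, [/\ D \subset V, [disjoint D & W], connected_in e D
       & [exists d in D, e d p] && [exists d in D, e d q]]} ->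
  ~ K5_minor_in (add_clique e S) (a |: W).
Proof.
move=> inst sWV S2 linkS K5; apply: (inst_free inst).
apply: (K5_minor_add_clique (inst_sym inst)) K5; rewrite ?setUS // => p q pS qS pq.
have [|[D [sDV dDW cD tD]]] := linkS p q pS qS pq; [by left | right].
exists D; split=> //; first by rewrite (subset_trans sDV) ?subsetUr.
rewrite disjoint_sym disjoints_subset subUset sub1set inE -disjoints_subset.
rewrite disjoint_sym dDW andbT.
by apply: contra (inst_apex inst); apply: subsetP.
Qed.

(** Both [z] and [z'] see the whole triangle [a], [x], [y]. If a path outside [P] joins them, the
    three vertices of the triangle, [z] and the rest of the path form a K5 minor. Otherwise [P]
    separates them, and it is already a clique. *)
Lemma color_twins (T C : finType) b (e : rel T) a (V P : {set T}) x y z z'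
    (L : T -> {set C}) :
  apex_instance b e a V P L -> x \in P -> y \in P -> x != y ->
  z \in V :\: P -> z' \in V :\: P -> z != z' ->
  [&& e a z, e x z & e y z] -> [&& e a z', e x z' & e y z'] ->
  colorable_below T C b (#|V| + #|V :\: P|) -> colorable_on b e V L.
Proof.
move=> inst xP yP xy zV z'V zz' /and3P[eaz exz eyz] /and3P[eaz' exz' eyz'] IH.
have [sym_e irr_e aV noK5 sPV P2 adjP cliqueP preP listP] := inst.
have [eax eay exy] : [/\ e a x, e a y & e x y].
  by split; rewrite ?adjP //; case/andP: (cliqueP x y xP yP xy).
pose K := component e (V :\: P) z.
have sK : K \subset V :\: P by apply: component_subset.
have sKV : K \subset V by apply: subset_trans sK (subsetDl _ _).
have zK : z \in K by apply: mem_component.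
have PK u : u \in P -> u \in K = false.
  by move=> uP; apply: contraTF uP => /(subsetP sK)/setDP[].
have [z'K|z'K] := boolP (z' \in K); last first.
  have AB : (K :|: P) :&: (V :\: K) = P.
    apply/setP=> u; rewrite in_setI in_setU in_setD.
    have [uP|uP] := boolP (u \in P); first by rewrite PK // (subsetP sPV).
    by rewrite orbF; case: (u \in K).
  have KV : K :|: P \subset V by rewrite subUset sKV.
  apply: (@color_separation _ _ _ _ _ _ P (K :|: P) (V :\: K) _ inst);
    rewrite ?AB ?subsetUr //.
  - apply/setP=> u; rewrite in_setU in_setU in_setD.
    have [uK|uK] := boolP (u \in K); first by rewrite (subsetP sKV).
    by have [uP|//] := boolP (u \in P); rewrite (subsetP sPV).
  - apply: contraNneq z'K => KPV; have /setDP[z'V' z'P] := z'V.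
    by move: z'V'; rewrite -KPV inE (negPf z'P) orbF.
  - apply/eqP=> /setP/(_ z); have /setDP[-> _] := zV.
    by rewrite inE zK.
  - move=> u v; rewrite !in_setD !in_setU => /andP[uN uKP] /andP[vN /andP[vK vV]].
    have uK : u \in K.
      move: uKP uN; case: (u \in K) => //= uP; by rewrite (subsetP sPV).
    move: vN; rewrite negb_or => /andP[_ vP]; apply: contra vK => euv.
    by apply: component_closed uK _ euv; rewrite // inE vP.
  - by apply: (inst_not_add_clique inst) => // u v uP vP uv; left; case/andP: (cliqueP u v uP vP uv).
  by apply: (inst_not_add_clique inst); rewrite ?subsetDl // => u v uP vP uv; left; case/andP: (cliqueP u v uP vP uv).
case: noK5; move: z'K; rewrite inE => /connectP[p0 /shortenP[p zp un _] z'p].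
case: p => [|u s] in zp un z'p *; first by rewrite z'p eqxx in zz'.
have sVP : {subset z :: u :: s <= V :\: P}.
  move: zp; elim: (u :: s) (z) zV => [|w t IHt] v vV /=.
    by move=> _ w; rewrite inE => /eqP->.
  case/andP=> /and3P[_ wV _] /(IHt w wV) sub i.
  by rewrite inE => /orP[/eqP->|/sub].
have /andP[ezu us] : e z u && path e u s.
  by apply: (sub_path _ zp) => i j /and3P[].
have notP i : i \in V :\: P -> [/\ i \in V, i != x & i != y].
  by case/setDP=> iV iP; split; rewrite //; apply: contraNneq iP => ->.
have notV i : i \in V -> i != a by move=> iV; apply: contraNneq aV => <-.
have Z'V i : i \in [set v in u :: s] -> i \in V :\: P.
  by rewrite inE => iS; apply: sVP; rewrite in_cons iS orbT.
have z'Z : z' \in [set v in u :: s] by rewrite inE z'p /= mem_last.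
have [xV yV] : x \in V /\ y \in V by rewrite !(subsetP sPV).
have [zV' zx zy] := notP z zV.
exists [:: [set a]; [set x]; [set y]; [set z]; [set v in u :: s]]; split=> //.
  rewrite /= !connected_in1 //= connected_in_path // !sub1set !inE eqxx xV yV zV' !orbT /=.
  rewrite andbT; apply/subsetP=> i /Z'V /setDP[iV _]; by rewrite inE iV orbT.
have Z'N i : i \notin V :\: P -> i \notin [set v in u :: s].
  by apply: contra => /Z'V.
have aN : a \notin V :\: P by rewrite inE (negPf aV) andbF.
have xN : x \notin V :\: P by rewrite in_setD xP.
have yN : y \notin V :\: P by rewrite in_setD yP.
rewrite /= !andbT; apply/and4P; split; last first.
- apply: touch1l ezu; last by rewrite inE mem_head.
  by move: un; rewrite /= inE => /andP[].
- by rewrite (touch1l _ (set11 z)) ?(touch1l (Z'N _ yN) z'Z) // inE eq_sym.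
- rewrite (touch1l _ (set11 y)) ?(touch1l _ (set11 z)) ?(touch1l (Z'N _ xN) z'Z) //.
    by rewrite inE eq_sym.
  by rewrite inE.
rewrite (touch1l _ (set11 x)) ?(touch1l _ (set11 y)) ?(touch1l _ (set11 z)) //;
  by rewrite ?(touch1l (Z'N _ aN) z'Z) // inE eq_sym notV.
Qed.

(** The clique [P] lies in the component [E] of [x] off the cycle, and [S] collects the cycle
    vertices that see [E]. When [S] has at most two vertices, each side of the separation obtains
    the edge on [S] through the other side: [E :|: S] through an arc of the cycle, [V :\: E] through
    [E]. *)
Lemma color_around_cycle (T C : finType) b (e : rel T) a (V P : {set T}) x c
    (L : T -> {set C}) :
  apex_instance b e a V P L -> x \in P ->
  cycle e c -> uniq c -> 2 < size c ->
  {in c, forall v, (v \in V :\: P) && e a v} ->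
  colorable_below T C b (#|V| + #|V :\: P|) -> colorable_on b e V L.
Proof.
move=> inst xP cyc un sz cY IH.
have [sym_e irr_e aV noK5 sPV P2 adjP cliqueP preP listP] := inst.
have eax := adjP x xP.
have cV v : v \in c -> v \in V by case/cY/andP=> /setDP[].
have cA v : v \in c -> e a v by case/cY/andP.
have cP v : v \in c -> v \notin P by case/cY/andP=> /setDP[].
pose F := V :\: [set v in c].
have PF : {subset P <= F}.
  move=> v vP; rewrite !inE (subsetP sPV v vP) andbT.
  by apply: contraL vP => /cP.
pose E := component e F x.
have sEF : E \subset F by apply: component_subset; apply: PF.
have xE : x \in E by apply: mem_component.
have cE : connected_in e E by apply: component_connected => //; apply: PF.
have PE : P \subset E.
  apply/subsetP=> v vP; have [<-//|xv] := eqVneq x v.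
  have /andP[exv _] := cliqueP x v xP vP xv.
  by apply: component_closed xE _ exv; apply: PF.
have sEV : E \subset V by apply: subset_trans sEF (subsetDl _ _).
have Ec v : v \in E -> v \notin c by move/(subsetP sEF); rewrite !inE => /andP[].
pose N p := [exists d in E, e d p].
pose S := [set p in c | N p].
have Sc p : p \in S -> p \in c by rewrite inE => /andP[].
have [S3|S2] := ltnP 2 #|S|.
  case: noK5; have /card_gt2P[p [q [r [[pS qS rS] ne]]]] := S3.
  have NS i : i \in S -> N i by rewrite inE => /andP[].
  have [s [sz_s pw_s all_s]] := cycle_tripod sym_e cyc un
    (And3 (Sc p pS) (Sc q qS) (Sc r rS)) ne (And3 (NS p pS) (NS q qS) (NS r rS)).
  exists [:: [set a], E & s]; split; first by rewrite /= sz_s.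
    rewrite /= connected_in1 // cE sub1set setU11 subsetU ?sEV ?orbT //=.
    apply: sub_all all_s => A /and3P[-> sA _] /=.
    by apply/subsetP=> v /(subsetP sA); rewrite !inE => /cV ->; rewrite orbT.
  rewrite /= pw_s andbT; apply/andP; split; last first.
    apply: sub_all all_s => A /and3P[_ sA /exists_inP[v vA /exists_inP[d dE edv]]].
    apply: touchI dE vA edv; rewrite disjoint_sym disjoints_subset.
    apply/subsetP=> w /(subsetP sA); rewrite !inE => wc.
    by apply: contraL wc => wE; apply: Ec; rewrite inE.
  apply/andP; split.
    by apply: touch1l xE eax; apply: contra aV; apply: subsetP.
  apply: sub_all all_s => A /and3P[_ sA /exists_inP[v vA _]].
  have inc w : w \in A -> w \in c by move/(subsetP sA); rewrite inE.
  apply: touch1l (vA) (cA v (inc v vA)).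
  by apply: contra aV => /inc/cV.
have SE p : p \in S -> p \notin E by move/Sc => pc; apply: contraL pc => /Ec.
have SV p : p \in S -> p \in V by move/Sc/cV.
have AB : (E :|: S) :&: (V :\: E) = S.
  apply/setP=> u; rewrite in_setI in_setU in_setD.
  have [uS|uS] := boolP (u \in S); first by rewrite (negPf (SE u uS)) SV.
  by rewrite orbF; case: (u \in E).
have sAV : E :|: S \subset V by rewrite subUset sEV; apply/subsetP.
apply: (@color_separation _ _ _ _ _ _ P (E :|: S) (V :\: E) _ inst);
  rewrite ?AB //.
- apply/setP=> u; rewrite in_setU in_setU in_setD.
  have [uE|uE] := boolP (u \in E); first by rewrite (subsetP sEV).
  by have [uS|//] := boolP (u \in S); rewrite SV.
- by rewrite (subset_trans PE) ?subsetUl.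
(* The cycle has at least three vertices, none in [E], and at most two of them are in [S]. *)
- apply/eqP=> ESV; have: size c <= #|S|.
    rewrite -(card_uniqP un); apply: subset_leq_card; apply/subsetP=> v vc.
    by have := cV v vc; rewrite -ESV in_setU => /orP[/Ec|//]; rewrite vc.
  by rewrite leqNgt (leq_ltn_trans S2).
- by apply/eqP=> /setP/(_ x); rewrite in_setD xE (subsetP sPV x xP).
- by move=> v /Sc/cA.
- move=> u v; rewrite !in_setD !in_setU => /andP[uN uES] /andP[vN /andP[vE vV]].
  have uE : u \in E.
    by move: uES uN; case: (u \in E) => //= uS; rewrite SV.
  apply: contra vN => euv; have [vc|vc] := boolP (v \in c).
    by apply/orP; right; rewrite inE vc; apply/exists_inP; exists u.
  rewrite (negPf vE) /=; case/negP: vE; apply: component_closed uE _ euv.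
    exact: PF.
  by rewrite !inE vc.
- apply: (inst_not_add_clique inst) => // p q pS qS pq; right.
  (* The bound on [#|S|] leaves no third vertex, so the arc from [cycle_link] avoids all of [S]. *)
  have defS : [set p; q] = S.
    apply/eqP; rewrite eqEcard subUset !sub1set pS qS.
    by rewrite (leq_trans S2) // cards2 pq.
  have [D [sD cD tD]] := cycle_link sym_e cyc un sz (Sc p pS) (Sc q qS) pq.
  exists D; split=> //.
    by apply/subsetP=> v /(subsetP sD)/setDP[]; rewrite inE => /cV.
  rewrite disjoints_subset; apply/subsetP=> v /(subsetP sD)/setDP[].
  rewrite defS in_set => vc vS; rewrite in_setC in_setU negb_or vS andbT.
  by apply: contraL vc => /Ec.
apply: (inst_not_add_clique inst); rewrite ?subsetDl // => p q pS qS pq; right.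
exists E; split=> //.
  by rewrite disjoints_subset; apply/subsetP=> v vE; rewrite in_setC in_setD vE.
by move: pS qS; rewrite [p \in S]inE [q \in S]inE => /andP[_ pN] /andP[_ qN]; apply/andP.
Qed.

(** * Colorability of every apex instance *)

(** When [P] has two vertices, a vertex of [Y] that cannot be deleted has two neighbors in [Y], or
    one there and both vertices of [P]. Two vertices of the second kind are twins; a single one can
    serve as the start of the path that yields a cycle in [Y]. *)
Lemma colorable_all (T C : finType) b n : colorable_below T C b n.
Proof.
elim: n => [//|n IHn] e a V P L inst le_n.
have {IHn le_n} IH : colorable_below T C b (#|V| + #|V :\: P|).
  by move=> e' a' V' P' L' inst' lt_m; apply: IHn inst' (leq_trans lt_m le_n).
have [sym_e irr_e aV noK5 sPV P2 adjP cliqueP preP listP] := inst.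
pose N z := [set w in (V :\: P) :\ z | e a w && e z w].
(* A precolored vertex without uncolored outer neighbors can be deleted, its whole list of size [b]
   being the reserve. *)
have delete x : x \in P -> N x = set0 -> colorable_on b e V L.
  move=> xP Nx0; have xV := subsetP sPV x xP.
  apply: (@color_delete_outer _ _ _ _ _ _ _ x _ (L x) inst) => //.
  - exact: adjP.
  - by rewrite -/(N x) Nx0 cards0.
  - by rewrite -/(N x) Nx0 cards0 mul1n preP.
  move=> v /setD1P[vx vP] _; rewrite eq_sym in vx.
  by case/andP: (cliqueP x v xP vP vx).
have [P1|P1] := leqP #|P| 1.
  have [/exists_inP[w wV /andP[eaw /forall_inP adjw]]|noext] :=
    boolP [exists w in V :\: P, e a w && [forall v in P, e v w]].
    exact: (@color_extend_precoloring _ _ _ _ _ _ _ w _ inst).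
  (* Since the precoloring does not extend, either [P] is a single vertex without uncolored outer
     neighbors, or [P] is empty and the apex has no neighbor in [V], so that all lists have at least
     [5 * b] colors. *)
  have [P0|[x xP]] := set_0Vmem P; last first.
    apply: (delete x xP); apply/setP=> w; rewrite !inE.
    apply: contraNF noext => /andP[/and3P[wx wP wV] /andP[eaw exw]].
    apply/exists_inP; exists w; rewrite ?inE ?wP // eaw.
    apply/forall_inP=> v vP; have /card_le1_eqP := P1 => /(_ x v xP vP) ->.
    by [].
  have [V0|[v vV]] := set_0Vmem V.
    by exists L; split=> u; rewrite V0 inE.
  apply: (@color_from_vertex _ _ _ _ _ v) => //.
  - by move=> K5; apply: noK5; apply: K5_minor_subset K5; apply: subsetUr.
  - move=> u uV; have := listP u; rewrite P0 setD0 => /(_ uV).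
    suff -> : e a u = false by [].
    apply: contraNF noext => eau; apply/exists_inP; exists u; rewrite P0 ?setD0 //.
    by rewrite eau; apply/forall_inP=> w; rewrite inE.
  by move: IH; rewrite P0 setD0.
have /card_gt1P[x [y [xP yP xy]]] := P1.
pose Y := [set z in V :\: P | e a z].
have YP z : z \in Y -> z \in V :\: P /\ e a z by rewrite inE => /andP[].
have NY z w : w \in N z -> w \in Y /\ e z w.
  by rewrite inE => /andP[/setD1P[_ wV] /andP[eaw ezw]]; rewrite inE wV.
have [Y0|[z zY]] := set_0Vmem Y.
  apply: (delete x xP); apply/setP=> w; rewrite [RHS]inE.
  by apply/negP=> /NY[]; rewrite Y0 inE.
pose PN z := [set v in P | e z v].
(* The second inequality makes [3 * b] colors suffice: the neighbors in [P] take at most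
   [#|PN u| * b] of them, which leaves [(#|N u|).+1 * b] for the reserve. *)
have [/exists_inP[u uY /andP[N1 PN2]]|allbad] :=
    boolP [exists u in Y, (#|N u| <= 1) && (#|N u| + #|PN u| <= 2)].
  have [uVP eau] := YP u uY; have /setDP[uV uP] := uVP.
  pose U := \bigcup_(v in PN u) L v.
  have cardU : #|U| <= #|PN u| * b.
    by apply: card_bigcup_const => v; rewrite inE => /andP[/preP ->].
  have [D sD cardD] : exists2 D : {set C}, D \subset L u :\: U & #|D| = #|N u|.+1 * b.
    apply: subset_of_card; have := leq_card_setD (L u) U; have := listP u uVP.
    have := leq_mul PN2 (leqnn b); rewrite eau mulnDl; lia.
  move: sD; rewrite subsetD => /andP[sDL dDU].
  apply: (@color_delete_outer _ _ _ _ _ _ _ u _ D inst) => //.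
  move=> v /setD1P[_ vP] euv; apply: disjointWr dDU.
  by apply: bigcup_sup; rewrite inE vP.
have bad u : u \in Y -> 1 < #|N u| \/ [/\ #|N u| = 1, e x u & e y u].
  move=> uY; have := exists_inPn allbad u uY.
  have sPN : PN u \subset P by apply/subsetP=> v; rewrite inE => /andP[].
  have := subset_leq_card sPN; have [|N1] := ltnP 1 #|N u|; first by left.
  rewrite /= -ltnNge => lePN ltN; right.
  have PNP : PN u = P by apply/eqP; rewrite eqEcard sPN; lia.
  have adjPu v : v \in P -> e v u by rewrite -PNP inE sym_e => /andP[].
  by split; [lia | apply: adjPu | apply: adjPu].
have [/existsP[u /existsP[v /and5P[uv uY vY tu tv]]]|notwins] :=
    boolP [exists u, exists v, [&& u != v, u \in Y, v \in Y, e x u && e y u & e x v && e y v]].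
  have [uV eau] := YP u uY; have [vV eav] := YP v vY.
  by apply: (@color_twins _ _ _ _ _ _ _ x y u v _ inst); rewrite ?eau ?eav.
have cardN u : u \in Y -> 0 < #|N u| by case/bad=> [/ltnW|[->]].
have cycle_from u : u \in Y -> {in Y, forall v, v != u -> 1 < #|N v|} -> colorable_on b e V L.
  move=> uY degY; have /card_gt0P[w /NY[wY euw]] := cardN u uY.
  have [|c [cyc un sz cY]] := exists_cycle sym_e irr_e uY wY euw.
    move=> v vY vu; apply: leq_trans (degY v vY vu) (subset_leq_card _).
    by apply/subsetP=> t /NY[tY evt]; rewrite inE tY.
  apply: (@color_around_cycle _ _ _ _ _ _ _ x c _ inst) => //.
  by move=> v /cY /YP[-> ->].
have [/exists_inP[u uY tu]|notwin] := boolP [exists u in Y, e x u && e y u].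
  apply: (cycle_from u) => // v vY vu; have [//|[_ exv eyv]] := bad v vY.
  case/negP: notwins; apply/existsP; exists u; apply/existsP; exists v.
  by rewrite eq_sym vu uY vY tu exv eyv.
apply: (cycle_from z) => // v vY _; have [//|[_ exv eyv]] := bad v vY.
by case/exists_inP: notwin; exists v; rewrite ?exv.
Qed.

(** * Choosability and the octahedra *)

Lemma K5_minor_in_is_minor (G : sgraph) :
  K5_minor_in (@adj G) [set: G] -> is_minor (complete 5) G.
Proof.
case=> s [sz_s /allP s_ok s_pw]; exists (fun i : 'I_5 => nth set0 s i).
have tch (i j : 'I_5) : i != j -> touch (@adj G) (nth set0 s i) (nth set0 s j).
  wlog ltij : i j / i < j.
    move=> IH ij; have [|] := ltnP i j; first by move/IH; apply.
    rewrite leq_eqVlt eq_sym => /orP[/eqP/val_inj eij|ltji].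
      by rewrite eij eqxx in ij.
    by rewrite touch_sym ?IH // 1?eq_sym //; apply: adj_sym.
  by move=> _; apply: (pairwiseP set0 s_pw); rewrite ?inE ?sz_s ?ltn_ord.
split=> [i|i j /tch/andP[]//|i j /tch/andP[_ /exists_inP[x xi /exists_inP[y yj xy]]]].
  have /s_ok/andP[cM _] : nth set0 s i \in s by rewrite mem_nth ?sz_s.
  split; first by case/andP: cM.
  by move=> x y xM yM; apply: connected_inP.
by exists x, y.
Qed.

Lemma choosable_leq a a' b (G : sgraph) :
  a <= a' -> choosable a b G -> choosable a' b G.
Proof.
move=> leaa' chG C L cardL.
have exL v : exists B : {set C}, (B \subset L v) && (#|B| == a).
  have [|B sB cB] := @subset_of_card _ (L v) a; first by rewrite cardL.
  by exists B; rewrite sB cB eqxx.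
have [|phi [sphi cphi dphi]] := chG C (fun v => xchoose (exL v)).
  by move=> v; have /andP[_ /eqP] := xchooseP (exL v).
exists phi; split=> // v; apply: subset_trans (sphi v) _.
by have /andP[] := xchooseP (exL v).
Qed.

Lemma K5_minor_free_choosable a b (G : sgraph) :
  5 * b <= a -> minor_free (complete 5) G -> choosable a b G.
Proof.
move=> le5 noK5 C L cardL.
have noK5' : ~ K5_minor_in (@adj G) [set: G] by move/K5_minor_in_is_minor.
have [V0|[v vG]] := set_0Vmem [set: G].
  have noG (u : G) : False by have := in_setT u; rewrite V0 inE.
  by exists L; split=> [u|u|u]; case: (noG u).
have [||u _||phi [sphi cphi dphi]] := @color_from_vertex _ _ b _ _ v L _ _ noK5' vG.
- exact: adj_sym.
- exact: adj_irrefl.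
- by rewrite cardL.
- exact: colorable_all.
exists phi; split=> [u|u|u w uw]; [exact: sphi | exact: cphi |].
exact/disjoint_setI0/dphi.
Qed.

(* A central triangle together with, for every index in [I], an outer triangle
   joined to it so that the two form an octahedron. *)
Definition octahedra_adj (I : finType) : rel ('I_3 + I * 'I_3) :=
  fun u v => match u, v with
    | inl i, inl j => i != j
    | inl i, inr (_, j) => i != j
    | inr (_, i), inl j => i != j
    | inr (f, i), inr (g, j) => (f == g) && (i != j)
  end.

Lemma octahedra_sym I : symmetric (@octahedra_adj I).
Proof. by move=> [i|[f i]] [j|[g j]] /=; rewrite (eq_sym i) // (eq_sym f). Qed.

Lemma octahedra_irrefl I : irreflexive (@octahedra_adj I).
Proof. by move=> [i|[f i]] /=; rewrite !eqxx. Qed.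

Definition octahedra (I : finType) : sgraph :=
  SGraph (@octahedra_sym I) (@octahedra_irrefl I).

(* Antipodal vertices of an octahedron share their position, so disjoint
   pairwise adjacent parts of size one have distinct positions. *)
Lemma octahedra_minor_free I : minor_free (complete 5) (octahedra I).
Proof.
case=> M [connM disjM adjM].
pose T := [set inl i | i : 'I_3] : {set octahedra I}.
(* The position is a proper 3-coloring of the graph. *)
pose pos (v : octahedra I) : 'I_3 := match v with inl i => i | inr (_, i) => i end.
have inT (v : octahedra I) : (v \in T) = if v is inl _ then true else false.
  case: v => [i|p]; first by rewrite imset_f.
  by apply/negP=> /imsetP[].
have le3 (A : {set complete 5}) (g : complete 5 -> 'I_3) :
    {in A &, injective g} -> #|A| <= 3.
  by move/card_in_imset=> <-; rewrite (leq_trans (max_card _)) ?card_ord.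
(* Disjoint branch sets meet the central triangle in distinct vertices, so at most three of the five
   do. *)
pose meets := [set h | M h :&: T != set0].
have meets3 : #|meets| <= 3.
  pose g (h : complete 5) := if [pick v in M h :&: T] is Some v then pos v else ord0.
  have gP h : h \in meets -> inl (g h) \in M h.
    rewrite inE /g; case: pickP => [v|no]; last first.
      by case/set0Pn=> v; rewrite no.
    by case: v => [i|p]; rewrite in_setI inT ?andbT ?andbF.
  apply: (le3 meets g) => h k hm km ghk.
  apply/eqP; apply/negPn/negP=> hk; have := disjointFr (disjM h k hk) (gP h hm).
  by rewrite ghk gP.
have [h hm] : exists h, h \notin meets.
  apply/existsP; rewrite -negb_forall; apply/negP=> /forallP all_m.
  have : #|'I_5| <= #|meets| by apply: subset_leq_card; apply/subsetP=> i _.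
  by rewrite card_ord leqNgt (leq_ltn_trans meets3).
have avoid k v : k \notin meets -> v \in M k -> exists f i, v = inr (f, i).
  rewrite inE negbK => /eqP Mk0 vM; case: v vM => [i|[f i] _]; last by exists f, i.
  by move=> iM; move/setP/(_ (inl i)): Mk0; rewrite in_setI iM inT inE.
(* No edge joins two outer triangles, so a connected set that avoids the central triangle stays in
   one of them. *)
have copy k f i : k \notin meets -> inr (f, i) \in M k ->
    forall v, v \in M k -> exists j, v = inr (f, j).
  move=> km fM v vM; have [_ /(_ _ v fM vM)/connectP[p + ->]] := connM k.
  elim: p i {fM v vM} => [|w p IHp] i /=; first by exists i.
  case/andP=> /and3P[_ wM iw] wp; have [g [j def_w]] := avoid k w km wM.
  by move: iw wp; rewrite def_w => /= /andP[/eqP <- _]; apply: IHp.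
have [v0 v0h] : exists v, v \in M h by have [/set0Pn] := connM h.
have [f [i0 def_v0]] := avoid h v0 hm v0h.
rewrite {}def_v0 in v0h.
(* This is the octahedron on the central triangle and the outer triangle around [M h]. It contains
   all neighbors of [M h], hence also every other branch set that avoids the central triangle. *)
pose O := [set v : octahedra I | if v is inr (g, _) then g == f else true].
have hO v : v \in M h -> v \in O by case/(copy h f i0 hm v0h) => j ->; rewrite inE.
have nbrO k u v : k \notin meets -> u \in M k -> u \in O -> adj u v -> v \in O.
  move=> km uM; have [g [j ->]] := avoid k u km uM; rewrite !inE => /eqP ->.
  by case: v => [//|[g' j']] /= /andP[/eqP ->].
have kO k v : k \notin meets -> v \in M k -> v \in O.
  have [->|kh km vM] := eqVneq k h; first by move=> _; apply: hO.
  have [x [y [xh yk xy]]] : exists x y, [/\ x \in M h, y \in M k & adj x y].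
    by apply: adjM; rewrite /= eq_sym.
  have yO := nbrO h x y hm xh (hO x xh) xy.
  have [g [j def_y]] := avoid k y km yk.
  have [i ->] := copy k g j km (eq_ind _ (fun z => z \in M k) yk _ def_y) v vM.
  by move: yO; rewrite def_y !inE.
(* If both sets meet the central triangle, one of its edges joins them; otherwise one of them lies
   in [O] together with its neighbors. The traces on [O] thus remain pairwise adjacent. *)
have adjO j k : j != k ->
    exists x y, [/\ x \in M j :&: O, y \in M k :&: O & adj x y].
  move=> jk; have [x [y [xj yk xy]]] := adjM j k jk.
  have [jm|jm] := boolP (j \in meets); last first.
    have xO := kO j x jm xj; have yO := nbrO j x y jm xj xO xy.
    by exists x, y; rewrite !in_setI xj yk xO yO.
  have [km|km] := boolP (k \in meets); last first.
    have yO := kO k y km yk; rewrite adj_sym in xy.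
    have xO := nbrO k y x km yk yO xy.
    by exists x, y; rewrite !in_setI xj yk xO yO adj_sym.
  move: jm km; rewrite !inE.
  case/set0Pn=> [[i|p]]; rewrite in_setI inT ?andbF // andbT => ij.
  case/set0Pn=> [[i'|p]]; rewrite in_setI inT ?andbF // andbT => ik.
  exists (inl i), (inl i'); rewrite !in_setI ij ik !inE; split=> //=.
  by apply: contraTneq ik => <-; rewrite (disjointFr (disjM j k jk)).
have adj_pos (u v : octahedra I) : adj u v -> pos u != pos v.
  by case: u v => [i|[g i]] [j|[g' j]] //= /andP[].
have cardO : #|O| <= 6.
  pose O' := [set inl i | i : 'I_3] :|: [set inr (f, i) | i : 'I_3] : {set octahedra I}.
  have sO : O \subset O'.
    apply/subsetP=> [[i|[g i]]]; rewrite !inE; first by rewrite imset_f.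
    by move/eqP->; rewrite imset_f ?orbT.
  apply: leq_trans (subset_leq_card sO) (leq_trans (leq_card_setU _ _) _).
  by apply: (@leq_add _ _ 3 3); rewrite (leq_trans (leq_imset_card _ _)) ?card_ord.
have sumM : \sum_k #|M k :&: O| <= #|O|.
  rewrite (eq_bigr (fun k => \sum_(v in O) (v \in M k))); last first.
    move=> k _; rewrite -sum1_card big_mkcond [RHS]big_mkcond /=.
    by apply: eq_bigr => v _; rewrite in_setI andbC; case: (v \in O); case: (v \in M k).
  rewrite exchange_big /= -sum1_card; apply: leq_sum => v _.
  rewrite [leqLHS](_ : _ = #|[set k | v \in M k]|); last first.
    by rewrite -sum1dep_card [RHS]big_mkcond; apply: eq_bigr => k _; case: (v \in M k).
  apply/card_le1_eqP=> j k; rewrite !inE => vj vk; apply/eqP/negPn/negP; rewrite eq_sym => jk.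
  by have := disjointFr (disjM j k jk) vj; rewrite vk.
have posM k : 0 < #|M k :&: O|.
  have [j jk] : exists j, j != k.
    by have [->|k0] := eqVneq k ord0; [exists ord_max | exists ord0; rewrite eq_sym].
  by have [x [y [_ yk _]]] := adjO j k jk; apply/card_gt0P; exists y.
(* Five disjoint nonempty traces share six vertices, so at most one has two or more. The other four
   are singletons with distinct positions, but there are only three positions. *)
pose Q := [set k | 1 < #|M k :&: O|].
have Q1 : #|Q| <= 1.
  have : 5 + #|Q| <= \sum_k #|M k :&: O|.
    have -> : 5 + #|Q| = \sum_k (1 + (1 < #|M k :&: O|)).
      rewrite big_split /= sum1_card card_ord; congr (_ + _).
      by rewrite -sum1dep_card big_mkcond; apply: eq_bigr => k _; case: ltnP.
    by apply: leq_sum => k _; case: ltnP => //; rewrite addn0 posM.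
  by move: cardO sumM; lia.
pose g (k : complete 5) := if [pick v in M k :&: O] is Some v then pos v else ord0.
have single k v : k \in ~: Q -> v \in M k :&: O -> g k = pos v.
  rewrite in_setC in_set -leqNgt => /card_le1_eqP k1 vk; rewrite /g.
  by case: pickP => [w wk|/(_ v)]; [rewrite (k1 w v) | rewrite vk].
have : #|~: Q| <= 3.
  apply: (le3 (~: Q) g) => j k jQ kQ gjk.
  apply/eqP/negPn/negP=> jk; have [x [y [xj yk /adj_pos]]] := adjO j k jk.
  by rewrite -(single j) // -(single k) // gjk eqxx.
by have := cardsC Q; rewrite card_ord; lia.
Qed.

(** * Lists without a coloring on the octahedra *)

Lemma card_bigcup_disjoint (I C : finType) (P : pred I) (F : I -> {set C}) n :
  (forall i j, i != j -> [disjoint F i & F j]) -> (forall i, #|F i| = n) ->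
  #|\bigcup_(i | P i) F i| = #|P| * n.
Proof.
move=> disjF cardF; rewrite big_mkcond -sum1_card partition_disjoint_bigcup /=.
  rewrite -sum_nat_const [RHS]big_mkcond; apply: eq_bigr => i _.
  by rewrite sum1_card unfold_in; case: ifP => _; rewrite ?cardF ?cards0.
move=> i j ij; case: ifP => _; case: ifP => _; rewrite ?disjF //;
  by rewrite -setI_eq0 ?set0I ?setI0.
Qed.

Lemma octahedra_not_choosable b : 0 < b ->
  exists I : finType, ~ choosable (5 * b).-1 b (octahedra I).
Proof.
move=> b_gt0; set m := (5 * b).-1; pose A := 'I_m; pose S := 'I_(3 * b).-1.
(* The index set of all triples of subsets of [A] includes every coloring of the central triangle;
   [S] provides the fresh colors. *)
exists {ffun 'I_3 -> {set A}} => chG; pose C : finType := (A + S)%type.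
pose free : {set C} := [set inr s | s : S].
pose L0 : {set C} := [set inl c | c : A].
have injl : injective (@inl A S) by move=> c d [].
have injr : injective (@inr A S) by move=> c d [].
have cardL0 : #|L0| = m by rewrite card_imset // card_ord.
have cardfree : #|free| = (3 * b).-1 by rewrite card_imset // card_ord.
pose used (f : {ffun 'I_3 -> {set A}}) (j : 'I_3) : {set C} :=
  [set inl c | c in \bigcup_(i | i != j) f i].
(* For triples that are not colorings the intended list may have the wrong size; the default [L0]
   then keeps the size equal to [m]. *)
pose L (v : octahedra {ffun 'I_3 -> {set A}}) : {set C} :=
  match v with
  | inl _ => L0
  | inr (f, j) => if #|used f j :|: free| == m then used f j :|: free else L0
  end.
have [|phi [sphi cphi dphi]] := chG C L.
  by move=> [i|[f j]] //=; case: ifP => // /eqP.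
(* The triple is read off the given coloring of the central triangle, and its own octahedron gives
   the contradiction. *)
pose f := [ffun i : 'I_3 => [set c : A | inl c \in phi (inl i)]].
have phiE i : phi (inl i) = [set inl c | c in f i].
  apply/setP=> -[c|s]; rewrite ffunE.
    by rewrite mem_imset // inE.
  apply/idP/imsetP=> [/(subsetP (sphi (inl i)))/imsetP|] [c] //.
have cardf i : #|f i| = b by rewrite -(cphi (inl i)) phiE card_imset.
have disjf i j : i != j -> [disjoint f i & f j].
  move=> ij; rewrite -setI_eq0 -(imset_eq0 (@inl A S)) imsetI; last by move=> c d _ _ [].
  by rewrite -!phiE dphi.
have cardU j : #|\bigcup_(i | i != j) f i| = 2 * b.
  rewrite (card_bigcup_disjoint _ disjf cardf); congr (_ * _).
  by have := cardC1 j; rewrite card_ord.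
(* For this triple the size is [2 * b + (3 * b).-1 = m], so the list is the intended one. *)
have Lf j : L (inr (f, j)) = used f j :|: free.
  rewrite /L ifT //; rewrite cardsU card_imset // cardU cardfree.
  rewrite (_ : used f j :&: free = set0) ?cards0 ?subn0; first by rewrite /m; lia.
  by apply/setP=> c; rewrite !inE; apply/negP=> /andP[/imsetP[d _ ->] /imsetP[]].
have phifree j : phi (inr (f, j)) \subset free.
  apply/subsetP=> c cj; have := subsetP (sphi (inr (f, j))) c cj.
  rewrite Lf inE => /orP[/imsetP[d /bigcupP[i ij di] def_c]|//].
  have /setP/(_ c) : phi (inl i) :&: phi (inr (f, j)) = set0 by apply: dphi.
  by rewrite in_setI cj phiE def_c mem_imset // di inE.
have dis i j : i != j -> [disjoint phi (inr (f, i)) & phi (inr (f, j))].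
  by move=> ij; rewrite -setI_eq0 dphi //= eqxx.
have : #|\bigcup_j phi (inr (f, j))| <= #|free|.
  by apply/subset_leq_card/bigcupsP=> j _; apply: phifree.
rewrite (card_bigcup_disjoint _ dis (fun j => cphi (inr (f, j)))) cardfree.
by rewrite eq_cardT // size_enum_ord; lia.
Qed.

Theorem theorem4p1 (a b : nat) (ha : (0 < a)%N) (hb : (0 < b)%N) :
  (forall G : sgraph, minor_free (complete 5) G -> choosable a b G) <->
  (5%:R <= a%:R / b%:R :> rat)%R.
Proof.
rewrite Num.Theory.ler_pdivlMr ?Num.Theory.ltr0n // -GRing.Theory.natrM Num.Theory.ler_nat.
split=> [chG | le5 G]; last exact: K5_minor_free_choosable.
rewrite leqNgt; apply/negP=> lt5; have [I []] := octahedra_not_choosable hb.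
(* Choosability passes to longer lists, and [a < 5 * b] gives [a <= (5 * b).-1]. *)
apply: choosable_leq (chG _ (@octahedra_minor_free I)).
by rewrite -ltnS prednK ?muln_gt0.
Qed.
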